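(* For any polynomial $f\in\mathbb{F}_3[X]$ of the form $f(X)=a_3X^3-a_1X-a_0$ with $a_3\neq 0$, at least one of the polynomials $f$, $f^{(2)}$, $f^{(3)}$ is reducible over $\mathbb{F}_3$.
   Context: The iterates are $f^{(0)}(X)=X$ and $f^{(n)}(X)=f^{(n-1)}(f(X))$ for $n\ge1$. *)

(* Defs.v *)
From mathcomp Require Import all_boot all_order all_algebra.

Set Implicit Arguments.
Unset Strict Implicit.
Unset Printing Implicit Defensive.

Import GRing.Theory.
Local Open Scope ring_scope.

(* [p \Po q] is p(q(X)), so the successor case reads f^(n)(X) = f^(n-1)(f(X)). *)
Fixpoint poly_iter (R : nzRingType) (f : {poly R}) (n : nat) : {poly R} :=
  if n is m.+1 then poly_iter f m \Po f else 'X.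

(* Failure of [irreducible_poly] alone would also hold of 0 and of the nonzero
   constants; being reducible excludes them, whence the bound on the size. *)
Definition reducible_poly (F : fieldType) (p : {poly F}) : Prop :=
  (1 < size p)%N /\ ~ irreducible_poly p.

(* Main.v *)
(** With [L = X^3 - X], either [a3 <> a1], and [f] acts on F_3 as an affine
    bijection, hence has a root, or [f = a3 L - a0] with [L] additive and
    vanishing on F_3. In the latter case [f^(3) = a3 (L^(3) - c)] where
    [c = a3 a0], and [L^(3) = X^27 - X = Y^9 + Y^3 + Y] for [Y = X^3 - X]. For
    [c <> 0], [Y^9 + Y^3 + Y - c] is the product of the irreducible cubics
    in [Y] of trace [c], as it expresses that the trace from F_27 to F_3 is [c]. *)
Require Import Defs.
From mathcomp Require Import all_boot all_order all_algebra.
From mathcomp Require Import ring.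

Set Implicit Arguments.
Unset Strict Implicit.
Unset Printing Implicit Defensive.

Import GRing.Theory.
Local Open Scope ring_scope.

Lemma reducible_poly_dvdp (F : fieldType) (p q : {poly F}) :
  (1 < size q < size p)%N -> q %| p -> reducible_poly p.
Proof.
case/andP=> q_gt1 lt_qp dvd_qp; split; first exact: ltn_trans lt_qp.
case=> _ /(_ q); rewrite neq_ltn q_gt1 orbT => /(_ isT dvd_qp) /eqp_size eq_qp.
by rewrite eq_qp ltnn in lt_qp.
Qed.

Lemma size_poly_iter (F : fieldType) (f : {poly F}) n :
  (size (poly_iter f n)).-1 = ((size f).-1 ^ n)%N.
Proof.
by elim: n => [|n IHn] /=; rewrite ?size_polyX // size_comp_poly IHn expnSr.
Qed.

Lemma size_cubic (F : fieldType) (a : F) (p : {poly F}) :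
  a != 0 -> (size p <= 3)%N -> size (a%:P * 'X^3 + p) = 4%N.
Proof.
by move=> a0 sp; rewrite mul_polyC size_polyDl size_scale // size_polyXn.
Qed.

Lemma F3_expr3 (x : 'F_3) : x ^+ 3 = x.
Proof. by case: x => [] [|[|[|//]]] i; apply: val_inj. Qed.

Lemma F3_sqr1 (x : 'F_3) : x != 0 -> x ^+ 2 = 1.
Proof. by case: x => [] [|[|[|//]]] i // _; apply: val_inj. Qed.

Lemma cubeB_char3 (R : comNzRingType) (x y : R) :
  3%:R = 0 :> R -> (x - y) ^+ 3 = x ^+ 3 - y ^+ 3.
Proof.
move=> char3.
have -> : (x - y) ^+ 3 = x ^+ 3 - y ^+ 3 - 3%:R * (x ^+ 2 * y - x * y ^+ 2).
  by ring.
by rewrite char3 mul0r subr0.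
Qed.

(** For [c] = 1 or -1 in F_3, the factors are the minimal polynomials of the nine elements of F_27
    of trace [c]; none of these lies in F_3, where the trace vanishes. *)
Lemma trace_factorization (R : comNzRingType) (c y : R) :
  3%:R = 0 :> R -> c ^+ 2 = 1 ->
  y ^+ 9 + y ^+ 3 + y - c =
  (y ^+ 3 - c * y ^+ 2 + c) *
  ((y ^+ 3 - c * y ^+ 2 + y + c) * (y ^+ 3 - c * y ^+ 2 - y - c)).
Proof.
move=> char3 c2.
have c3 : c ^+ 3 = c by rewrite exprS c2 mulr1.
(* The multiple of 3 is the discrepancy between the two sides over the integers, modulo
   [c ^+ 2 = 1]. *)
transitivity (y ^+ 9 + y ^+ 3 + y - c
  + 3%:R * (- c * y ^+ 8 + y ^+ 7 - y ^+ 5 - y)).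
  by rewrite char3 mul0r addr0.
(* The right-hand side, expanded only as far as needed to reduce powers of [c]. *)
transitivity (y ^+ 9 - 3%:R * c * y ^+ 8 + 3%:R * c ^+ 2 * y ^+ 7
  - c ^+ 3 * y ^+ 6 + c * y ^+ 6 - 2%:R * c ^+ 2 * y ^+ 5 + c ^+ 3 * y ^+ 4
  - (y ^+ 5 + 2%:R * c * y ^+ 4 + c ^+ 2 * y ^+ 3 - c * y ^+ 4
     - 2%:R * c ^+ 2 * y ^+ 3 - c ^+ 3 * y ^+ 2 + c * y ^+ 2
     + 2%:R * c ^+ 2 * y + c ^+ 3)); last by ring.
by rewrite c3 c2; ring.
Qed.

Lemma poly_F3_char3 : 3%:R = 0 :> {poly 'F_3}.
Proof. by rewrite -polyC_natr; congr _%:P; apply: val_inj. Qed.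

Lemma poly_iter3_artin_schreier (a b : 'F_3) (y := 'X^3 - 'X : {poly 'F_3}) :
  a ^+ 2 = 1 ->
  poly_iter (a%:P * y - b%:P) 3 =
  a%:P * (y ^+ 9 + y ^+ 3 + y - (a * b)%:P).
Proof.
move=> a2; have A2 : a%:P ^+ 2 = 1 :> {poly 'F_3} by rewrite -polyC_exp a2.
have cube (c : 'F_3) : c%:P ^+ 3 = c%:P by rewrite -polyC_exp F3_expr3.
set f := a%:P * y - b%:P.
(* Cubing is additive and fixes constants, so [b] cancels. *)
have y_f : y \Po f = a%:P * (y ^+ 3 - y).
  rewrite comp_polyB comp_Xn_poly comp_polyX /f.
  by rewrite (cubeB_char3 _ _ poly_F3_char3) exprMn !cube; ring.
have f_comp q : f \Po q = a%:P * (y \Po q) - b%:P.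
  by rewrite comp_polyB comp_polyM !comp_polyC.
rewrite /= comp_polyX [X in X \Po f]f_comp y_f comp_polyB comp_polyM.
rewrite comp_polyM comp_polyB rmorphXn /= !comp_polyC y_f exprMn cube.
rewrite (cubeB_char3 _ _ poly_F3_char3) polyCM.
(* Iterating [y ^+ 3 - y] gives the middle term [-2 y^3], here split as [y^3 - 3 y^3]. *)
transitivity (a%:P ^+ 2 * a%:P * (y ^+ 9 + y ^+ 3 + y - 3%:R * y ^+ 3) - b%:P).
  by ring.
rewrite poly_F3_char3 A2 mul0r subr0.
(* Writing [b] as [a ^+ 2 * b] lets [a] factor out. *)
transitivity (a%:P * (y ^+ 9 + y ^+ 3 + y) - a%:P ^+ 2 * b%:P); last by ring.
by rewrite A2; ring.
Qed.

Theorem theorem4p3 (f : {poly 'F_3}) (a3 a1 a0 : 'F_3) (ha3 : a3 != 0)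
    (hf : f = a3%:P * 'X^3 - a1%:P * 'X - a0%:P) :
  [\/ reducible_poly f,
      reducible_poly (poly_iter f 2)
    | reducible_poly (poly_iter f 3)].
Proof.
have size_f : size f = 4%N.
  rewrite hf -addrA -opprD; apply: size_cubic => //.
  rewrite size_polyN (leq_trans (size_polyD _ _)) // geq_max mul_polyC.
  rewrite (leq_trans (size_scale_leq _ _)) ?size_polyX //.
  exact: leq_trans (size_polyC_leq1 _) _.
have [[x fx0] | no_root] : (exists x, root f x) \/ (forall x, ~~ root f x).
  case: (boolP [exists x, root f x]) => [/existsP|]; first by left.
  by rewrite negb_exists => /forallP; right.
- constructor 1; apply: (@reducible_poly_dvdp _ _ ('X - x%:P)).
    by rewrite size_XsubC size_f.
  by rewrite dvdp_XsubCl.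
have f_val x : f.[x] = (a3 - a1) * x - a0.
  by rewrite hf !(hornerXn, hornerD, hornerN, hornerM, hornerC, hornerX) F3_expr3
    mulrBl.
have eq_a : a3 = a1.
  apply/eqP; rewrite -subr_eq0; apply: contraT => nz.
  (* The zero of the affine map in [f_val]. *)
  have := no_root (a0 / (a3 - a1)).
  by rewrite rootE f_val mulrCA mulfV // mulr1 subrr eqxx.
have a0_neq0 : a0 != 0.
  by have := no_root 0; rewrite rootE f_val mulr0 sub0r oppr_eq0.
constructor 3; set y : {poly 'F_3} := 'X^3 - 'X; set c := a3 * a0.
have c2 : c%:P ^+ 2 = 1 :> {poly 'F_3}.
  by rewrite -polyC_exp F3_sqr1 // mulf_neq0.
have f_y : f = a3%:P * y - a0%:P by rewrite hf -eq_a /y; ring.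
have size_f3 : (size (poly_iter f 3)).-1 = 27%N by rewrite size_poly_iter size_f.
(* The first factor in [trace_factorization], taken at [y]: degree 9, a proper divisor in degree
   27. *)
pose g : {poly 'F_3} := ('X^3 - c%:P * 'X^2 + c%:P) \Po y.
have size_g : (size g).-1 = 9%N.
  rewrite size_comp_poly.
  have -> : size y = 4%N.
    by rewrite /y -['X^3]mul1r size_cubic ?oner_eq0 ?size_polyN ?size_polyX.
  rewrite -addrA -['X^3]mul1r size_cubic ?oner_eq0 //.
  rewrite (leq_trans (size_polyD _ _)) // geq_max size_polyN mul_polyC.
  rewrite (leq_trans (size_scale_leq _ _)) ?size_polyXn //.
  exact: leq_trans (size_polyC_leq1 _) _.
apply: (@reducible_poly_dvdp _ _ g).
  (* Since [.-1] truncates, size 0 has to be excluded. *)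
  have size_lt m n : m.-1 = 9%N -> n.-1 = 27%N -> (1 < m < n)%N.
    by case: m n => [|m] [|n] //= -> ->.
  exact: size_lt size_g size_f3.
rewrite f_y poly_iter3_artin_schreier ?F3_sqr1 // -/y -/c.
rewrite (trace_factorization y poly_F3_char3 c2) dvdp_mull // dvdp_mulr //.
by rewrite /g !(comp_Xn_poly, comp_polyB, comp_polyD, comp_polyM, comp_polyC).
Qed.
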